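(* There is an integer $n_0\ge 3$ such that every connected graph $H$ with $n\ge n_0$ vertices has geometric pebbling threshold at most $$\frac{2^{\sqrt{2\log_2 n}}\, e}{2\sqrt{\log_2 n}}\left(1-(\log_2 n)^{-1/4}\right)^{-1} n.$$
   Context: Pebbling: a distribution on a graph assigns a nonnegative integer number of pebbles to each vertex. A pebbling move removes two pebbles from a vertex having at least two pebbles and adds one pebble to an adjacent vertex. A vertex is pebblable if some sequence of pebbling moves from the distribution ends with at least one pebble on it; a distribution is solvable if every vertex is pebblable. The geometric distribution on $\{0,1,2,\dots\}$ with parameter $0<p\le 1$ assigns probability $p(1-p)^k$ to $k$. For a graph $H$ with $n>0$ vertices, the geometric pebbling threshold of $H$ is the unique positive real $x$ such that, if an independent geometrically distributed number of pebbles with parameter $(1+x/n)^{-1}$ is placed on each vertex of $H$, the probability that the distribution is solvable equals $\tfrac12$. *)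

(* Defs.v *)
From Stdlib Require Import Reals Lra Lia Arith List ClassicalEpsilon.
From Stdlib Require Import Relations.
Import ListNotations.
Open Scope R_scope.

Definition simple_graph (n : nat) (adj : nat -> nat -> Prop) : Prop :=
  (forall u v, (u < n)%nat -> (v < n)%nat -> adj u v -> adj v u) /\
  (forall v, (v < n)%nat -> ~ adj v v).

Definition connected (n : nat) (adj : nat -> nat -> Prop) : Prop :=
  forall u v, (u < n)%nat -> (v < n)%nat ->
    clos_refl_trans nat
      (fun a b => (a < n)%nat /\ (b < n)%nat /\ adj a b) u v.

(* A distribution: number of pebbles on each vertex (values at w >= n unused). *)
Definition distribution := nat -> nat.

Definition pebbling_move (n : nat) (adj : nat -> nat -> Prop)
    (D D' : distribution) : Prop :=
  exists v u, (v < n)%nat /\ (u < n)%nat /\ adj v u /\ (2 <= D v)%nat /\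
    D' = (fun w => if Nat.eqb w v then (D v - 2)%nat
                   else if Nat.eqb w u then (D u + 1)%nat else D w).

Definition pebblable (n : nat) (adj : nat -> nat -> Prop)
    (D : distribution) (r : nat) : Prop :=
  exists D', clos_refl_trans distribution (pebbling_move n adj) D D' /\
    (1 <= D' r)%nat.

Definition solvable (n : nat) (adj : nat -> nat -> Prop)
    (D : distribution) : Prop :=
  forall r, (r < n)%nat -> pebblable n adj D r.

Fixpoint bounded_dists (k M : nat) : list distribution :=
  match k with
  | O => [fun _ => O]
  | S k' => flat_map (fun f => map (fun a => fun w => if Nat.eqb w k' then a else f w)
                                    (seq 0 (S M)))
                     (bounded_dists k' M)
  end.

(* Probability of D when each vertex independently gets a geometric(p)
   number of pebbles: prod_{v<n} p (1-p)^{D v}. *)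
Definition geom_weight (n : nat) (p : R) (D : distribution) : R :=
  fold_right Rmult 1 (map (fun v => p * (1 - p) ^ (D v)) (seq 0 n)).

Definition indicator (P : Prop) : R :=
  if excluded_middle_informative P then 1 else 0.

(* Partial sums (over distributions with all counts <= M) of the probability
   that the random distribution is solvable; their limit as M -> oo is the
   probability of solvability. *)
Definition solvable_prob_partial (n : nat) (adj : nat -> nat -> Prop) (p : R)
    (M : nat) : R :=
  fold_right Rplus 0
    (map (fun D => geom_weight n p D * indicator (solvable n adj D))
         (bounded_dists n M)).

Definition geom_param (n : nat) (x : R) : R := / (1 + x / INR n).

Definition is_geom_threshold (n : nat) (adj : nat -> nat -> Prop) (x : R) : Prop :=
  0 < x /\ Un_cv (solvable_prob_partial n adj (geom_param n x)) (1/2).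

Definition log2 (y : R) : R := ln y / ln 2.

Definition threshold_bound (n : nat) : R :=
  let L := log2 (INR n) in
  Rpower 2 (sqrt (2 * L)) * exp 1 / (2 * sqrt L)
    * / (1 - Rpower L (-(1/4))) * INR n.

(* Main.v *)
(* Let L = log2 n, T = sqrt (2 L), let m be the least integer above T, and let mu be
   the mean number of pebbles per vertex.  By a union bound it suffices that each
   root r is unpebblable with probability at most 1/(4n).
   If a shortest path w_0 = r, w_1, ..., w_(m-1) ends at r, then failure at r forces
   sum_i D(w_i) / 2^i < 1; the Laplace transform at s = m bounds the probability by
   e^m prod_(i<m) (1 + 2^i/m)/mu, which is about e^m 2^(m(m-1)/2) / (m mu)^m, and mu
   is exactly large enough for this to be o(1/n): the factor 1 - L^(-1/4) gains
   exp(- sqrt m), more than the exp(O(log^2 m)) lost in the approximation.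
   Otherwise all vertices are within distance m - 1 of r, and failure forces all n
   independent counts to stay below 2^(m-1), which is far less likely. *)
Require Import Defs.
From Stdlib Require Import Reals.
From Stdlib Require Import Lra Lia ZArith List Permutation Relations ClassicalEpsilon.
Import ListNotations.
Open Scope R_scope.

(** * Finite sums and products over lists *)

Definition rsum {A : Type} (l : list A) (f : A -> R) : R :=
  fold_right Rplus 0 (map f l).

Definition rprod {A : Type} (l : list A) (f : A -> R) : R :=
  fold_right Rmult 1 (map f l).

Lemma rsum_app {A} (l1 l2 : list A) f : rsum (l1 ++ l2) f = rsum l1 f + rsum l2 f.
Proof.
  unfold rsum; induction l1 as [|a l IH]; simpl; [ring | rewrite IH; ring].
Qed.

Lemma rprod_app {A} (l1 l2 : list A) f : rprod (l1 ++ l2) f = rprod l1 f * rprod l2 f.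
Proof.
  unfold rprod; induction l1 as [|a l IH]; simpl; [ring | rewrite IH; ring].
Qed.

Lemma rsum_le {A} (l : list A) f g :
  (forall a, In a l -> f a <= g a) -> rsum l f <= rsum l g.
Proof.
  unfold rsum; induction l as [|a l IH]; simpl; intros H; [lra|].
  apply Rplus_le_compat; auto.
Qed.

Lemma rsum_ext {A} (l : list A) f g :
  (forall a, In a l -> f a = g a) -> rsum l f = rsum l g.
Proof.
  intros H; apply Rle_antisym; apply rsum_le; intros a Ha; rewrite H; auto; lra.
Qed.

Lemma rsum_scal {A} (l : list A) c f : rsum l (fun a => c * f a) = c * rsum l f.
Proof.
  unfold rsum; induction l as [|a l IH]; simpl; [ring | rewrite IH; ring].
Qed.

Lemma rsum_plus {A} (l : list A) f g :
  rsum l (fun a => f a + g a) = rsum l f + rsum l g.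
Proof.
  unfold rsum; induction l as [|a l IH]; simpl; [ring | rewrite IH; ring].
Qed.

Lemma rsum_const {A} (l : list A) c : rsum l (fun _ => c) = INR (length l) * c.
Proof.
  unfold rsum; induction l as [|a l IH]; [simpl; ring|].
  cbn [map fold_right length]. rewrite IH, S_INR; ring.
Qed.

Lemma rsum_swap {A B} (l : list A) (k : list B) f :
  rsum l (fun a => rsum k (fun b => f a b)) = rsum k (fun b => rsum l (fun a => f a b)).
Proof.
  induction l as [|a l IH].
  - change (0 = rsum k (fun _ => 0)). rewrite rsum_const; ring.
  - change (rsum k (f a) + rsum l (fun a => rsum k (fun b => f a b)) =
            rsum k (fun b => f a b + rsum l (fun a => f a b))).
    rewrite IH, rsum_plus; reflexivity.
Qed.

Lemma rprod_nonneg {A} (l : list A) f : (forall a, In a l -> 0 <= f a) -> 0 <= rprod l f.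
Proof.
  unfold rprod; induction l as [|a l IH]; simpl; intros H; [lra|].
  apply Rmult_le_pos; auto.
Qed.

Lemma rprod_le {A} (l : list A) f g :
  (forall a, In a l -> 0 <= f a <= g a) -> rprod l f <= rprod l g.
Proof.
  induction l as [|a l IH]; intros H; [apply Rle_refl|].
  change (f a * rprod l f <= g a * rprod l g).
  apply Rmult_le_compat.
  - apply H; left; auto.
  - apply rprod_nonneg; intros b Hb; apply H; right; auto.
  - apply H; left; auto.
  - apply IH; intros b Hb; apply H; right; auto.
Qed.

Lemma rprod_ext {A} (l : list A) f g :
  (forall a, In a l -> f a = g a) -> rprod l f = rprod l g.
Proof.
  unfold rprod; induction l as [|a l IH]; simpl; intros H; [reflexivity|].
  rewrite IH, H; auto.
Qed.

Lemma rprod_mult {A} (l : list A) f g :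
  rprod l (fun a => f a * g a) = rprod l f * rprod l g.
Proof.
  unfold rprod; induction l as [|a l IH]; simpl; [ring | rewrite IH; ring].
Qed.

Lemma rprod_const {A} (l : list A) c : rprod l (fun _ => c) = c ^ length l.
Proof.
  unfold rprod; induction l as [|a l IH]; simpl; [ring | rewrite IH; ring].
Qed.

Lemma rprod_exp {A} (l : list A) f : rprod l (fun a => exp (f a)) = exp (rsum l f).
Proof.
  unfold rprod, rsum; induction l as [|a l IH]; simpl;
    [symmetry; apply exp_0 | rewrite IH, exp_plus; reflexivity].
Qed.

Lemma rprod_map {A B} (h : A -> B) (l : list A) f :
  rprod (map h l) f = rprod l (fun a => f (h a)).
Proof. unfold rprod; rewrite map_map; reflexivity. Qed.

Lemma rprod_perm {A} (l1 l2 : list A) f :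
  Permutation l1 l2 -> rprod l1 f = rprod l2 f.
Proof.
  unfold rprod; induction 1; simpl; try ring.
  - rewrite IHPermutation; ring.
  - congruence.
Qed.

Lemma exp_pow_INR (z : R) (k : nat) : exp z ^ k = exp (INR k * z).
Proof.
  induction k as [|k IH].
  - simpl; rewrite Rmult_0_l, exp_0; reflexivity.
  - cbn [pow]; rewrite IH, <- exp_plus, S_INR; f_equal; ring.
Qed.

(** Serves to split a product over all vertices into the factors on a path and those off it. *)
Lemma NoDup_incl_permutation {A} (P V : list A) :
  NoDup P -> NoDup V -> incl P V ->
  exists Q, Permutation V (P ++ Q).
Proof.
  intros HP; revert V; induction HP as [|a P Ha HP IH]; intros V HV Hi.
  - exists V; apply Permutation_refl.
  - destruct (in_split a V) as (V1 & V2 & ->); [apply Hi; left; auto|].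
    destruct (IH (V1 ++ V2)) as [Q HQ].
    + eapply NoDup_remove_1; eauto.
    + intros b Hb. assert (b <> a) by congruence.
      specialize (Hi b (or_intror Hb)).
      apply in_app_or in Hi; apply in_or_app; destruct Hi as [|[|]]; auto; congruence.
    + exists Q; simpl. rewrite <- HQ. symmetry; apply Permutation_middle.
Qed.

(** * Pebbling along paths *)

(** The root is [w 0]; edges point from [w (S i)] to [w i], the direction in which pebbles
    travel. *)
Definition path_to (n : nat) (adj : nat -> nat -> Prop) (w : nat -> nat) (l : nat) : Prop :=
  (forall i, (i <= l)%nat -> (w i < n)%nat) /\
  (forall i, (i < l)%nat -> adj (w (S i)) (w i)).

Definition inj_upto (w : nat -> nat) (l : nat) : Prop :=
  forall i j, (i <= l)%nat -> (j <= l)%nat -> w i = w j -> i = j.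

(* [2 ^ l] times the sum of [D (w i) / 2 ^ i]. *)
Fixpoint path_weight (D : nat -> nat) (w : nat -> nat) (l : nat) : nat :=
  match l with
  | O => D (w O)
  | S l' => 2 * path_weight D w l' + D (w l)
  end.

Lemma path_weight_ge_last D w l : (D (w l) <= path_weight D w l)%nat.
Proof. destruct l; simpl; lia. Qed.

Lemma path_weight_rsum D w l :
  INR (path_weight D w l) =
  2 ^ l * rsum (seq 0 (S l)) (fun i => INR (D (w i)) * / 2 ^ i).
Proof.
  induction l as [|l IH].
  - unfold rsum; simpl; field.
  - rewrite seq_S, rsum_app, Rmult_plus_distr_l.
    cbn [path_weight]. rewrite plus_INR, mult_INR, IH.
    unfold rsum at 3; cbn [map fold_right].
    rewrite Nat.add_0_l. replace (INR 2) with 2 by (simpl; ring).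
    assert (2 ^ S l <> 0) by (apply pow_nonzero; lra).
    cbn [pow] in *. field. lra.
Qed.

(** Nothing is recorded about the final count on [v], because the induction along a path discards
    its far end. *)
Lemma pebbling_moves_many n adj v u k :
  (v < n)%nat -> (u < n)%nat -> adj v u -> v <> u ->
  forall D, (2 * k <= D v)%nat ->
  exists D', clos_refl_trans _ (pebbling_move n adj) D D' /\
    D' u = (D u + k)%nat /\ (forall y, y <> u -> y <> v -> D' y = D y).
Proof.
  intros Hv Hu Ha Hne; induction k as [|k IH]; intros D HD.
  - exists D; split; [apply rt_refl|]; split; [lia|auto].
  - pose (D1 := fun y => if Nat.eqb y v then (D v - 2)%nat
                   else if Nat.eqb y u then (D u + 1)%nat else D y).
    assert (E1 : D1 v = (D v - 2)%nat) by (unfold D1; rewrite Nat.eqb_refl; auto).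
    assert (E2 : D1 u = (D u + 1)%nat).
    { unfold D1. rewrite Nat.eqb_refl. destruct (Nat.eqb_spec u v); auto; lia. }
    destruct (IH D1) as (D' & HR & H1 & H2); [lia|].
    exists D'; split; [|split].
    + eapply rt_trans; [apply rt_step|exact HR].
      exists v, u; repeat split; auto; lia.
    + lia.
    + intros y Hyu Hyv; rewrite H2; auto. unfold D1.
      destruct (Nat.eqb_spec y v); [congruence|].
      destruct (Nat.eqb_spec y u); [congruence|auto].
Qed.

Lemma path_weight_ext D D' w l :
  (forall i, (i <= l)%nat -> D (w i) = D' (w i)) -> path_weight D w l = path_weight D' w l.
Proof.
  induction l as [|l IH]; intros H; cbn [path_weight].
  - apply H; lia.
  - rewrite IH, H; auto.
Qed.

(** Move as much as possible from the far end to its neighbour and recurse on the shorter path.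
    Rounding down [a / 2] costs nothing: twice the new weight is at least [2 ^ (l + 1) - 1] and
    even, hence at least [2 ^ (l + 1)]. *)
Lemma path_pebblable n adj w l :
  path_to n adj w l -> inj_upto w l ->
  forall D, (2 ^ l <= path_weight D w l)%nat -> pebblable n adj D (w O).
Proof.
  induction l as [|l IH]; intros [Hn Ha] Hi D HD.
  - exists D; split; [apply rt_refl | exact HD].
  - cbn [path_weight] in HD.
    set (a := D (w (S l))) in *.
    pose proof (Nat.div_mod_eq a 2) as Hdm.
    pose proof (Nat.mod_upper_bound a 2 ltac:(lia)) as Hm.
    destruct (pebbling_moves_many n adj (w (S l)) (w l) (a / 2)) with (D := D)
      as (D1 & HR & H1 & H2).
    + apply Hn; lia.
    + apply Hn; lia.
    + apply Ha; lia.
    + intros E; apply Hi in E; lia.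
    + fold a; lia.
    + assert (HW : path_weight D1 w l = (path_weight D w l + a / 2)%nat).
      { destruct l as [|l']; cbn [path_weight].
        - exact H1.
        - rewrite H1. rewrite (path_weight_ext D1 D w l'); [lia|].
          intros i Hil; apply H2; intros E; apply Hi in E; lia. }
      assert (HP : pebblable n adj D1 (w O)).
      { apply IH.
        - split; intros; [apply Hn | apply Ha]; lia.
        - intros i j Hi' Hj' E; apply Hi; auto.
        - rewrite HW. rewrite Nat.pow_succ_r' in HD. lia. }
      destruct HP as (D' & HR' & HD').
      exists D'; split; auto. eapply rt_trans; eauto.
Qed.

Lemma connected_path n adj r u :
  connected n adj -> (r < n)%nat -> (u < n)%nat ->
  exists l w, path_to n adj w l /\ w O = r /\ w l = u.
Proof.
  intros HC Hr Hu.
  (* The walk runs from [u] to [r], so its steps already point towards the root, and its first step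
     appends one vertex at the far end of [w]. *)
  pose proof (clos_rt_rt1n _ _ _ _ (HC u r Hu Hr)) as H.
  clear HC; induction H as [x|x y z (Hx & Hy & Hxy) H IH].
  - exists O, (fun _ => x); repeat split; auto; lia.
  - destruct IH as (l & w & (Hn & Ha) & H0 & Hl); auto.
    exists (S l), (fun i => if Nat.leb i l then w i else x).
    split; [split|split].
    + intros i Hi; destruct (Nat.leb_spec i l); auto.
    + intros i Hi.
      destruct (Nat.leb_spec i l); [|lia].
      destruct (Nat.leb_spec (S i) l); [apply Ha; lia|].
      replace i with l by lia; rewrite Hl; auto.
    + exact H0.
    + destruct (Nat.leb_spec (S l) l); [lia|auto].
Qed.

(** Strong induction on the length: if [w i = w j] with [i < j], cutting out the closed walk between
    them shortens the walk and keeps both ends. *)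
Lemma connected_simple_path n adj r u :
  connected n adj -> (r < n)%nat -> (u < n)%nat ->
  exists l w, path_to n adj w l /\ w O = r /\ w l = u /\ inj_upto w l.
Proof.
  intros HC Hr Hu.
  destruct (connected_path n adj r u HC Hr Hu) as (l & w & H).
  revert w H; induction l as [l IH] using lt_wf_ind; intros w ((Hn & Ha) & H0 & Hl).
  destruct (excluded_middle_informative (inj_upto w l)) as [Hi|Hi].
  { exists l, w; repeat split; auto. }
  assert (Hij : exists i j, (i < j <= l)%nat /\ w i = w j).
  { apply NNPP; intros Hno; apply Hi; intros i j Hil Hjl E.
    destruct (Nat.lt_trichotomy i j) as [|[|]]; auto; exfalso; apply Hno;
      [exists i, j | exists j, i]; split; auto; lia. }
  destruct Hij as (i & j & Hij & E).
  apply (IH (l - (j - i))%nat) with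
    (w := fun k => if Nat.leb k i then w k else w (k + (j - i))%nat); [lia|].
  split; [split|split].
  - intros k Hk; destruct (Nat.leb_spec k i); apply Hn; lia.
  - intros k Hk. destruct (Nat.leb_spec k i).
    + destruct (Nat.leb_spec (S k) i); [apply Ha; lia|].
      replace k with i by lia. rewrite E.
      replace (S i + (j - i))%nat with (S j) by lia. apply Ha; lia.
    + destruct (Nat.leb_spec (S k) i); [lia|]. apply Ha; lia.
  - exact H0.
  - destruct (Nat.leb_spec (l - (j - i)) i).
    + replace (l - (j - i))%nat with i by lia. rewrite E.
      replace l with j in Hl by lia; auto.
    + replace (l - (j - i) + (j - i))%nat with l by lia; auto.
Qed.

(* Near the root every pile of size [2 ^ m] suffices; otherwise there is a path
   of length [m] leading to the root. *)
Lemma unpebblable_dichotomy n adj r m :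
  connected n adj -> (r < n)%nat ->
  (forall D, ~ pebblable n adj D r -> forall v, (v < n)%nat -> (D v < 2 ^ m)%nat) \/
  (exists w, (forall i, (i <= m)%nat -> (w i < n)%nat) /\ inj_upto w m /\
     forall D, ~ pebblable n adj D r -> (path_weight D w m < 2 ^ m)%nat).
Proof.
  intros HC Hr.
  destruct (excluded_middle_informative
    (exists w, path_to n adj w m /\ w O = r /\ inj_upto w m)) as [(w & Hw & H0 & Hi)|Hno].
  - right; exists w; split; [apply Hw|split; auto].
    intros D HD. apply Nat.nle_gt; intros HH; apply HD; rewrite <- H0.
    eapply path_pebblable; eauto.
  - left; intros D HD v Hv.
    destruct (connected_simple_path n adj r v HC Hr Hv) as (l & w & Hw & H0 & Hl & Hi).
    destruct (Nat.lt_ge_cases l m) as [Hlm|Hlm].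
    + apply Nat.nle_gt; intros HH; apply HD; rewrite <- H0.
      apply (path_pebblable n adj w l); auto.
      pose proof (path_weight_ge_last D w l) as HL. rewrite Hl in HL.
      pose proof (Nat.pow_le_mono_r 2 l m ltac:(lia) ltac:(lia)). lia.
    (* A simple path with at least [m] edges contains one with exactly [m], namely its part nearest
       the root. *)
    + exfalso; apply Hno; exists w; split; [|split]; auto.
      * destruct Hw as [H1 H2]; split; intros; [apply H1|apply H2]; lia.
      * intros i j Hi' Hj' E; apply Hi; auto; lia.
Qed.

(** * Geometric product measure *)

(** Independence of the vertices: each bounded distribution arises from one on the earlier vertices
    by choosing the last count freely, so the sum factors by distributivity. *)
Lemma rsum_bounded_dists n M (g : nat -> nat -> R) :
  rsum (bounded_dists n M) (fun D => rprod (seq 0 n) (fun v => g v (D v))) =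
  rprod (seq 0 n) (fun v => rsum (seq 0 (S M)) (g v)).
Proof.
  induction n as [|n IH].
  - unfold rsum, rprod; simpl; ring.
  - rewrite seq_S, rprod_app, <- IH. cbn [Nat.add].
    unfold rprod at 3; cbn [map fold_right]; rewrite Rmult_1_r, Rmult_comm, <- rsum_scal.
    cbn [bounded_dists]. generalize (bounded_dists n M) as L.
    induction L as [|D L IHL]; [reflexivity|].
    cbn [flat_map]. rewrite rsum_app, IHL.
    unfold rsum at 4; cbn [map fold_right]; fold (rsum L (fun a =>
      rsum (seq 0 (S M)) (g n) * rprod (seq 0 n) (fun v => g v (a v)))).
    f_equal.
    rewrite (Rmult_comm (rsum _ _)), <- rsum_scal.
    unfold rsum; rewrite map_map; fold (rsum (seq 0 (S M)) (fun x =>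
      rprod (seq 0 n ++ [n]) (fun v => g v (if Nat.eqb v n then x else D v)))).
    apply (rsum_ext (seq 0 (S M))); intros a _.
    rewrite rprod_app. f_equal.
    + apply rprod_ext; intros v Hv; apply in_seq in Hv.
      destruct (Nat.eqb_spec v n); [lia|auto].
    + unfold rprod; cbn [map fold_right]; rewrite Nat.eqb_refl; ring.
Qed.

Lemma rsum_pow (q : R) N : (1 - q) * rsum (seq 0 N) (pow q) = 1 - q ^ N.
Proof.
  induction N as [|N IH].
  - unfold rsum; simpl; ring.
  - rewrite seq_S, rsum_app, Rmult_plus_distr_l, IH.
    unfold rsum; simpl; ring.
Qed.

Lemma rsum_geom (p : R) N : rsum (seq 0 N) (fun a => p * (1 - p) ^ a) = 1 - (1 - p) ^ N.
Proof.
  rewrite rsum_scal, <- rsum_pow. ring.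
Qed.

Lemma rsum_geom_lt (p : R) K N : 0 < p <= 1 ->
  rsum (seq 0 N) (fun a => p * (1 - p) ^ a * (if Nat.ltb a K then 1 else 0))
  <= 1 - (1 - p) ^ K.
Proof.
  intros Hp.
  assert (E : rsum (seq 0 N) (fun a => p * (1 - p) ^ a * (if Nat.ltb a K then 1 else 0))
          = 1 - (1 - p) ^ Nat.min N K).
  { induction N as [|N IH].
    - unfold rsum; simpl; ring.
    - rewrite seq_S, rsum_app, IH. unfold rsum; cbn [map fold_right Nat.add].
      destruct (Nat.ltb_spec N K).
      + rewrite !Nat.min_l by lia. simpl; ring.
      + rewrite !Nat.min_r by lia. ring. }
  rewrite E.
  destruct (Nat.min_spec N K) as [[H ->]|[H ->]]; [|lra].
  assert ((1 - p) ^ K <= (1 - p) ^ N); [|lra].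
  replace K with (N + (K - N))%nat by lia. rewrite pow_add.
  assert (0 <= (1 - p) ^ N) by (apply pow_le; lra).
  assert ((1 - p) ^ (K - N) <= 1).
  { apply Rle_trans with (1 ^ (K - N)); [apply pow_incr; split; lra | rewrite pow1; lra]. }
  nra.
Qed.

(** A geometric series with ratio [q = (1 - p) e^(-t)]. From [q <= e^(-t) <= 1 / (1 + t)] follows
    [1 / (1 - q) <= 1 + 1 / t]. *)
Lemma rsum_geom_laplace (p t : R) N : 0 < p <= 1 -> 0 < t ->
  rsum (seq 0 N) (fun a => p * (1 - p) ^ a * exp (- (t * INR a))) <= p * (1 + / t).
Proof.
  intros Hp Ht.
  set (q := (1 - p) * exp (- t)).
  rewrite (rsum_ext _ _ (fun a => p * q ^ a)).
  2:{ intros a _. unfold q. rewrite Rpow_mult_distr, exp_pow_INR.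
      replace (INR a * - t) with (- (t * INR a)) by ring. ring. }
  rewrite rsum_scal. apply Rmult_le_compat_l; [lra|].
  assert (He : exp (- t) * (1 + t) <= 1).
  { assert (exp (- t) * exp t = 1) by (rewrite <- exp_plus, Rplus_opp_l; apply exp_0).
    pose proof (exp_ineq1 t ltac:(lra)). pose proof (exp_pos (- t)). nra. }
  pose proof (exp_pos (- t)) as Hpos.
  assert (Hq0 : 0 <= q) by (unfold q; apply Rmult_le_pos; lra).
  assert (Hq1 : q <= exp (- t)) by (unfold q; nra).
  pose proof (rsum_pow q N) as HS.
  assert (0 <= q ^ N) by (apply pow_le; auto).
  assert (Hq : t <= (1 - q) * (1 + t)) by nra.
  set (S := rsum _ _) in *.
  assert (HS0 : 0 <= S).
  { apply Rle_trans with (rsum (seq 0 N) (fun _ => 0)).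
    - rewrite rsum_const; lra.
    - apply rsum_le; intros a _; apply pow_le; auto. }
  apply Rmult_le_reg_l with t; auto.
  replace (t * (1 + / t)) with (1 + t) by (field; lra).
  apply Rle_trans with ((1 - q) * (1 + t) * S); [apply Rmult_le_compat_r; auto|nra].
Qed.

Lemma indicator_le P (c : R) : 0 <= c -> (P -> 1 <= c) -> indicator P <= c.
Proof. unfold indicator; destruct (excluded_middle_informative P); auto. Qed.

(** Uses the same truncation as [solvable_prob_partial]; the bounds on it below are uniform in
    [M]. *)
Definition partial_prob (n : nat) (p : R) (M : nat) (E : distribution -> Prop) : R :=
  rsum (bounded_dists n M) (fun D => geom_weight n p D * indicator (E D)).

Lemma geom_weight_nonneg n p D : 0 < p <= 1 -> 0 <= geom_weight n p D.
Proof.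
  intros Hp; apply (rprod_nonneg (seq 0 n)); intros v _.
  apply Rmult_le_pos; [lra|apply pow_le; lra].
Qed.

(* Markov's inequality for a product functional of the pebble counts. *)
Lemma partial_prob_markov n p M (E : distribution -> Prop) (c : R) (g : nat -> nat -> R) :
  0 < p <= 1 -> 0 <= c -> (forall v a, 0 <= g v a) ->
  (forall D, E D -> 1 <= c * rprod (seq 0 n) (fun v => g v (D v))) ->
  partial_prob n p M E <=
  c * rprod (seq 0 n) (fun v => rsum (seq 0 (S M)) (fun a => p * (1 - p) ^ a * g v a)).
Proof.
  intros Hp Hc Hg HE.
  rewrite <- (rsum_bounded_dists n M (fun v a => p * (1 - p) ^ a * g v a)), <- rsum_scal.
  apply rsum_le; intros D _. rewrite rprod_mult.
  change (rprod (seq 0 n) (fun v => p * (1 - p) ^ D v)) with (geom_weight n p D).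
  apply Rle_trans with
    (geom_weight n p D * (c * rprod (seq 0 n) (fun v => g v (D v)))); [|right; ring].
  apply Rmult_le_compat_l; [apply geom_weight_nonneg; auto|].
  apply indicator_le; auto.
  apply Rmult_le_pos; auto. apply rprod_nonneg; auto.
Qed.

(** Markov with 0-1 valued factors: the event lies in a product event whose coordinates each have
    probability at most [1 - (1 - p) ^ K]. *)
Lemma partial_prob_all_small n p M K (E : distribution -> Prop) :
  0 < p <= 1 -> (forall D, E D -> forall v, (v < n)%nat -> (D v < K)%nat) ->
  partial_prob n p M E <= (1 - (1 - p) ^ K) ^ n.
Proof.
  intros Hp HE.
  eapply Rle_trans.
  - apply (partial_prob_markov n p M E 1 (fun _ a => if Nat.ltb a K then 1 else 0)); auto.
    + lra.
    + intros _ a; destruct (Nat.ltb a K); lra.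
    + intros D HD. rewrite Rmult_1_l, (rprod_ext _ _ (fun _ => 1)).
      * rewrite rprod_const, pow1; lra.
      * intros v Hv; apply in_seq in Hv.
        destruct (Nat.ltb_spec (D v) K); auto. specialize (HE D HD v); lia.
  - rewrite Rmult_1_l, rprod_const, length_seq.
    apply pow_incr; split; [|apply rsum_geom_lt; auto].
    apply Rle_trans with (rsum (seq 0 (S M)) (fun _ => 0)).
    + rewrite rsum_const; lra.
    + apply rsum_le; intros a _. apply Rmult_le_pos.
      * apply Rmult_le_pos; [lra|apply pow_le; lra].
      * destruct (Nat.ltb a K); lra.
Qed.

(** Supplies the Laplace rates as a function of the vertex, with rate 0 off the path; injectivity of
    [w] makes the values on the path well defined. *)
Lemma function_along_path (w : nat -> nat) (l : nat) (c : nat -> R) :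
  inj_upto w l ->
  exists t : nat -> R, (forall i, (i <= l)%nat -> t (w i) = c i) /\
    (forall v, ~ In v (map w (seq 0 (S l))) -> t v = 0).
Proof.
  intros Hi.
  exists (fun v => match excluded_middle_informative (exists i, (i <= l)%nat /\ w i = v) with
    | left H => c (proj1_sig (constructive_indefinite_description _ H))
    | right _ => 0 end).
  split.
  - intros i Hil. destruct (excluded_middle_informative _) as [H|H].
    + destruct (constructive_indefinite_description _ H) as (j & Hj & E); simpl.
      f_equal; apply Hi; auto.
    + exfalso; apply H; eauto.
  - intros v Hv. destruct (excluded_middle_informative _) as [(i & Hil & <-)|H]; auto.
    exfalso; apply Hv, in_map, in_seq; lia.
Qed.

(** Exponential Markov inequality with rate [s / 2 ^ i] at [w i]. A vertex off the path has rate 0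
    and contributes at most the total mass 1 of its law. *)
Lemma partial_prob_light_path n p M w l (s : R) (E : distribution -> Prop) :
  0 < p <= 1 -> 0 < s ->
  (forall i, (i <= l)%nat -> (w i < n)%nat) -> inj_upto w l ->
  (forall D, E D -> (path_weight D w l < 2 ^ l)%nat) ->
  partial_prob n p M E <=
  exp s * rprod (seq 0 (S l)) (fun i => p * (1 + 2 ^ i / s)).
Proof.
  intros Hp Hs Hn Hi HE.
  destruct (function_along_path w l (fun i => s / 2 ^ i) Hi) as (t & Ht & Ht0).
  destruct (NoDup_incl_permutation (map w (seq 0 (S l))) (seq 0 n)) as [Q HQ].
  { apply NoDup_map_NoDup_ForallPairs; [|apply seq_NoDup].
    intros i j Hi' Hj' HE'; apply in_seq in Hi', Hj'; apply Hi; auto; lia. }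
  { apply seq_NoDup. }
  { intros v Hv; apply in_map_iff in Hv; destruct Hv as (i & <- & Hi').
    apply in_seq in Hi'; apply in_seq; specialize (Hn i); lia. }
  (* [Q] is disjoint from the path, since together they permute a list without repetitions. *)
  assert (HQ0 : forall v, In v Q -> t v = 0).
  { intros v Hv; apply Ht0; intros Hv'.
    assert (ND : NoDup (map w (seq 0 (S l)) ++ Q))
      by (eapply Permutation_NoDup; [exact HQ|apply seq_NoDup]).
    clear -ND Hv Hv'. induction (map w (seq 0 (S l))) as [|a P IH]; [easy|].
    inversion ND; subst; destruct Hv' as [->|]; auto.
    apply H1, in_or_app; auto. }
  eapply Rle_trans.
  - apply (partial_prob_markov n p M E (exp s) (fun v a => exp (- (t v * INR a)))); auto.
    + left; apply exp_pos.
    + intros; left; apply exp_pos.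
    + intros D HD. rewrite (rprod_perm _ _ _ HQ), rprod_app, rprod_map.
      rewrite (rprod_ext Q _ (fun _ => 1)).
      2:{ intros v Hv; rewrite HQ0, Rmult_0_l, Ropp_0; auto; apply exp_0. }
      rewrite rprod_const, pow1, Rmult_1_r.
      rewrite rprod_exp, <- exp_plus, <- exp_0 at 1.
      rewrite (rsum_ext _ _ (fun i => - s * (INR (D (w i)) * / 2 ^ i))).
      2:{ intros i Hi'; apply in_seq in Hi'; rewrite Ht by lia.
          unfold Rdiv; ring. }
      rewrite rsum_scal.
      specialize (HE D HD); apply lt_INR in HE.
      rewrite path_weight_rsum, pow_INR in HE. replace (INR 2) with 2 in HE by (simpl; ring).
      set (S0 := rsum _ _) in *.
      assert (0 < 2 ^ l) by (apply pow_lt; lra).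
      assert (S0 < 1) by nra.
      assert (0 <= s + - s * S0) as [|<-] by nra; [left; apply exp_increasing; auto | right; auto].
  - apply Rmult_le_compat_l; [left; apply exp_pos|].
    rewrite (rprod_perm _ _ _ HQ), rprod_app, rprod_map, <- (Rmult_1_r (rprod _ (fun i => p * _))).
    assert (Hnn : forall v, 0 <= rsum (seq 0 (S M)) (fun a => p * (1 - p) ^ a * exp (- (t v * INR a)))).
    { intros v. apply Rle_trans with (rsum (seq 0 (S M)) (fun _ => 0)).
      - rewrite rsum_const; lra.
      - apply rsum_le; intros a _. apply Rmult_le_pos; [|left; apply exp_pos].
        apply Rmult_le_pos; [lra|apply pow_le; lra]. }
    apply Rmult_le_compat; try (apply rprod_nonneg; auto).
    + apply rprod_le; intros i Hi'; split; auto.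
      apply in_seq in Hi'; rewrite Ht by lia.
      assert (0 < 2 ^ i) by (apply pow_lt; lra).
      replace (2 ^ i / s) with (/ (s / 2 ^ i)) by (field; lra).
      apply rsum_geom_laplace; auto. apply Rdiv_lt_0_compat; auto.
    + apply Rle_trans with (rprod Q (fun _ => 1)); [|rewrite rprod_const, pow1; lra].
      apply rprod_le; intros v Hv; split; auto.
      rewrite HQ0 by auto.
      rewrite (rsum_ext _ _ (fun a => p * (1 - p) ^ a)).
      2:{ intros a _; rewrite Rmult_0_l, Ropp_0, exp_0; ring. }
      rewrite rsum_geom. assert (0 <= (1 - p) ^ S M) by (apply pow_le; lra). lra.
Qed.

(** The power on the left is the total mass of the distributions with all counts at most [M]. Each
    of them is solvable or fails at some root. *)
Lemma union_bound n adj p M (b : R) :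
  0 < p <= 1 ->
  (forall r, (r < n)%nat -> partial_prob n p M (fun D => ~ pebblable n adj D r) <= b) ->
  (1 - (1 - p) ^ S M) ^ n - INR n * b <= solvable_prob_partial n adj p M.
Proof.
  intros Hp Hb.
  assert (E : (1 - (1 - p) ^ S M) ^ n = rsum (bounded_dists n M) (geom_weight n p)).
  { change (geom_weight n p) with
      (fun D : distribution => rprod (seq 0 n) (fun v => p * (1 - p) ^ D v)).
    rewrite (rsum_bounded_dists n M (fun _ a => p * (1 - p) ^ a)), rprod_const, length_seq.
    rewrite rsum_geom; auto. }
  assert (H : rsum (bounded_dists n M) (geom_weight n p) <=
    rsum (bounded_dists n M) (fun D => geom_weight n p D * indicator (solvable n adj D)
      + rsum (seq 0 n) (fun r => geom_weight n p D * indicator (~ pebblable n adj D r)))).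
  { apply rsum_le; intros D _. rewrite rsum_scal, <- Rmult_plus_distr_l.
    rewrite <- (Rmult_1_r (geom_weight n p D)) at 1.
    apply Rmult_le_compat_l; [apply geom_weight_nonneg; auto|].
    assert (Hind : forall P, 0 <= indicator P)
      by (intros P; unfold indicator; destruct (excluded_middle_informative P); lra).
    destruct (excluded_middle_informative (solvable n adj D)) as [Hs|Hs].
    - assert (0 <= rsum (seq 0 n) (fun r => indicator (~ pebblable n adj D r))).
      { apply Rle_trans with (rsum (seq 0 n) (fun _ => 0)).
        - rewrite rsum_const; lra.
        - apply rsum_le; auto. }
      unfold indicator at 1; destruct (excluded_middle_informative _); [lra|easy].
    - assert (Hr : exists r, (r < n)%nat /\ ~ pebblable n adj D r).
      { apply NNPP; intros Hno; apply Hs; intros r Hr; apply NNPP; eauto. }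
      destruct Hr as (r & Hr & HD).
      destruct (in_split r (seq 0 n)) as (l1 & l2 & ->); [apply in_seq; lia|].
      rewrite rsum_app.
      change (rsum (r :: l2) ?f) with (f r + rsum l2 f); cbn beta.
      assert (H0 : forall l, 0 <= rsum l (fun r => indicator (~ pebblable n adj D r))).
      { intros l; apply Rle_trans with (rsum l (fun _ => 0)).
        - rewrite rsum_const; lra.
        - apply rsum_le; auto. }
      pose proof (H0 l1); pose proof (H0 l2); pose proof (Hind (solvable n adj D)).
      assert (indicator (~ pebblable n adj D r) = 1)
        by (unfold indicator; unfold indicator; destruct (excluded_middle_informative (~ pebblable n adj D r)); [auto|contradiction]).
      lra. }
  rewrite rsum_plus, rsum_swap in H.
  change (rsum (bounded_dists n M) (fun D => geom_weight n p D * indicator (solvable n adj D)))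
    with (solvable_prob_partial n adj p M) in H.
  assert (H' : rsum (seq 0 n) (fun r => partial_prob n p M (fun D => ~ pebblable n adj D r))
     <= INR n * b).
  { rewrite <- (length_seq n 0) at 2. rewrite <- rsum_const.
    apply rsum_le; intros r Hr; apply Hb; apply in_seq in Hr; lia. }
  unfold partial_prob in H'. lra.
Qed.

(** * Asymptotics *)

(** Since [1 + 2^i/m = (2^i/m) (1 + m/2^i)], this is the price of replacing every [1 + 2^i/m] with
    [i < m] by [2^i/m]. *)
Definition rounding_factor (m : nat) : R := rprod (seq 0 m) (fun i => 1 + INR m / 2 ^ i).

Lemma exp_le_mono x y : x <= y -> exp x <= exp y.
Proof. intros [H| ->]; [left; apply exp_increasing; auto | right; auto]. Qed.

Lemma rprod_one_plus_geom_le (c : R) k j : 0 <= c ->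
  rprod (seq k j) (fun i => 1 + c / 2 ^ i) <= exp (2 * c / 2 ^ k).
Proof.
  intros Hc.
  assert (Hpow : forall i, 0 < 2 ^ i) by (intros; apply pow_lt; lra).
  (* The exponent is the exact value of the sum of [c / 2 ^ i] over the list; keeping the subtracted
     tail lets the induction close. *)
  apply Rle_trans with (exp (2 * c / 2 ^ k - 2 * c / 2 ^ (k + j))).
  - induction j as [|j IH].
    + rewrite Nat.add_0_r, Rminus_diag, exp_0. unfold rprod; simpl; lra.
    + rewrite seq_S, rprod_app. unfold rprod at 2; cbn [map fold_right].
      rewrite Rmult_1_r.
      replace (2 * c / 2 ^ k - 2 * c / 2 ^ (k + S j)) with
        ((2 * c / 2 ^ k - 2 * c / 2 ^ (k + j)) + c / 2 ^ (k + j)).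
      2:{ rewrite Nat.add_succ_r; cbn [pow]. pose proof (Hpow k); pose proof (Hpow (k + j)%nat).
          field; lra. }
      rewrite exp_plus.
      assert (0 <= c / 2 ^ (k + j)) by (apply Rle_mult_inv_pos; auto).
      apply Rmult_le_compat; auto; [|lra|apply exp_ineq1_le].
      apply rprod_nonneg; intros i _.
      assert (0 <= c / 2 ^ i) by (apply Rle_mult_inv_pos; auto). lra.
  - apply exp_le_mono.
    assert (0 <= 2 * c / 2 ^ (k + j)) by (apply Rle_mult_inv_pos; auto; lra). lra.
Qed.

(** The first [k] factors are each at most [1 + m]; the exponents of the others form a geometric
    series. *)
Lemma rounding_factor_le m k : (k <= m)%nat ->
  rounding_factor m <= (1 + INR m) ^ k * exp (2 * INR m / 2 ^ k).
Proof.
  intros Hk. unfold rounding_factor.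
  replace (seq 0 m) with (seq 0 k ++ seq k (m - k))
    by (rewrite <- seq_app; f_equal; lia).
  pose proof (pos_INR m).
  assert (Hpow : forall i, 1 <= 2 ^ i) by (intros; apply pow_R1_Rle; lra).
  assert (Hnn : forall i, 0 <= 1 + INR m / 2 ^ i <= 1 + INR m).
  { intros i. specialize (Hpow i).
    assert (0 <= INR m / 2 ^ i) by (apply Rle_mult_inv_pos; lra).
    assert (INR m / 2 ^ i <= INR m); [|lra].
    apply Rmult_le_reg_r with (2 ^ i); [lra|].
    unfold Rdiv; rewrite Rmult_assoc, Rinv_l by lra. nra. }
  rewrite rprod_app. apply Rmult_le_compat.
  - apply rprod_nonneg; intros; apply Hnn.
  - apply rprod_nonneg; intros; apply Hnn.
  - apply Rle_trans with (rprod (seq 0 k) (fun _ => 1 + INR m)).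
    + apply rprod_le; auto.
    + rewrite rprod_const, length_seq; lra.
  - apply rprod_one_plus_geom_le; auto.
Qed.

(** The source of the constant 17: [18^4 = 104976] is below [2^17 = 131072], whereas [17^4] exceeds
    [2^16]. Afterwards the left side grows by less than a factor 2 per step. *)
Lemma pow4_le_pow2 k : (17 <= k)%nat -> (INR k + 1) ^ 4 <= 2 ^ k.
Proof.
  induction 1 as [|k Hk IH].
  - simpl; lra.
  - rewrite S_INR. cbn [pow] in *. apply le_INR in Hk. simpl in Hk.
    set (y := INR k + 1) in *.
    assert (Hy : 18 <= y) by (unfold y; lra).
    apply Rle_trans with (2 * (y * (y * (y * (y * 1))))); [|lra].
    assert (18 * y <= y * y) by nra.
    assert (18 * (y * y) <= y * (y * y)) by nra.
    assert (18 * (y * (y * y)) <= y * (y * (y * y))) by nra.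
    lra.
Qed.

Lemma ln2_bounds : 1 / 2 < ln 2 < 1.
Proof.
  split.
  - pose proof ln_lt_2; lra.
  - rewrite <- ln_exp. apply ln_increasing; [lra|].
    pose proof (exp_ineq1 1 ltac:(lra)); lra.
Qed.

(* The first [m ^ (1/4)] factors contribute a power of [1 + m] of that order and
   the others a bounded amount, so the product is subexponential in [sqrt m]. *)
Lemma rounding_factor_subexp m : (17 ^ 4 <= m)%nat ->
  4 * exp 1 * rounding_factor m <= exp (sqrt (INR m)).
Proof.
  intros Hm.
  set (a := Nat.sqrt m). set (k := Nat.sqrt a).
  pose proof (Nat.sqrt_spec m ltac:(lia)) as [Ha1 Ha2]. fold a in Ha1, Ha2.
  pose proof (Nat.sqrt_spec a ltac:(lia)) as [Hk1 Hk2]. fold k in Hk1, Hk2.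
  assert (Ha : (17 ^ 2 <= a)%nat).
  { apply (proj1 (Nat.sqrt_le_square _ _)). rewrite <- Nat.pow_add_r. exact Hm. }
  assert (Hk : (17 <= k)%nat).
  { apply (proj1 (Nat.sqrt_le_square _ _)). rewrite <- Nat.pow_2_r. exact Ha. }
  assert (Hkm : (k <= m)%nat) by nia.
  assert (R1 : (INR k * INR k) * (INR k * INR k) <= INR m).
  { rewrite <- !mult_INR; apply le_INR; nia. }
  assert (R2 : 1 + INR m <= (INR k + 1) ^ 4).
  { replace ((INR k + 1) ^ 4) with (INR ((S k * S k) * (S k * S k)))
      by (rewrite !mult_INR, S_INR; ring).
    replace (1 + INR m) with (INR (S m)) by (rewrite S_INR; ring).
    apply le_INR; nia. }
  pose proof (pow4_le_pow2 k Hk) as R3.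
  apply le_INR in Hk. replace (INR 17) with 17 in Hk by (simpl; lra).
  pose proof (pos_INR m).
  assert (Hs : INR k * INR k <= sqrt (INR m)).
  { rewrite <- (sqrt_square (INR k * INR k)) by nra. apply sqrt_le_1_alt; auto. }
  (* Tangent line of the logarithm at 16: with [y = k + 1], [ln y = ln (y/16) + 4 ln 2 <= (y/16 - 1)
     + 3]. *)
  assert (Hln : ln (1 + INR m) <= 4 * ((INR k + 1) / 16 + 2)).
  { apply Rle_trans with (ln ((INR k + 1) ^ 4)).
    - destruct R2 as [R2| <-]; [left; apply ln_increasing; lra | right; auto].
    - rewrite ln_pow by lra. replace (INR 4) with 4 by (simpl; ring).
      apply Rmult_le_compat_l; [lra|].
      replace (INR k + 1) with ((INR k + 1) / 16 * 2 ^ 4) at 1 by (simpl; field).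
      rewrite ln_mult, ln_pow by (simpl; lra).
      replace (INR 4) with 4 by (simpl; ring).
      pose proof ln2_bounds.
      assert (0 < (INR k + 1) / 16) by lra.
      pose proof (exp_ineq1_le (ln ((INR k + 1) / 16))) as He.
      rewrite exp_ln in He by auto.
      (* Squaring [exp (3/32) > 1 + 3/32] three times gives [exp (3/4) > 2]. *)
      assert (ln 2 < 3/4).
      { rewrite <- (ln_exp (3/4)). apply ln_increasing; [lra|].
        replace (3/4) with (3/8 + 3/8) by field. rewrite exp_plus.
        pose proof (exp_ineq1 (3/8) ltac:(lra)).
        replace (3/8) with (3/16+3/16) in * by field. rewrite exp_plus in *.
        pose proof (exp_ineq1 (3/16) ltac:(lra)).
        replace (3/16) with (3/32+3/32) in * by field. rewrite exp_plus in *.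
        pose proof (exp_ineq1 (3/32) ltac:(lra)).
        assert (1.196 <= exp (3/32) * exp (3/32)) by nra.
        set (e := exp (3/32) * exp (3/32)) in *.
        assert (1.43 <= e * e) by nra.
        nra. }
      lra. }
  assert (Hq : 2 * INR m / 2 ^ k <= 2).
  { assert (0 < 2 ^ k) by (apply pow_lt; lra).
    apply Rmult_le_reg_r with (2 ^ k); auto.
    unfold Rdiv; rewrite Rmult_assoc, Rinv_l by lra. lra. }
  apply Rle_trans with (exp (ln 2 * 2) * exp 1 *
    (exp (INR k * ln (1 + INR m)) * exp (2 * INR m / 2 ^ k))).
  - replace (exp (ln 2 * 2)) with 4.
    2:{ replace (ln 2 * 2) with (ln 2 + ln 2) by ring.
        rewrite exp_plus, exp_ln; lra. }
    apply Rmult_le_compat_l; [pose proof (exp_pos 1); lra|].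
    rewrite <- (exp_pow_INR (ln (1 + INR m)) k), exp_ln by lra.
    apply rounding_factor_le; auto.
  - rewrite <- !exp_plus. apply exp_le_mono. pose proof ln2_bounds.
    (* The total exponent is at most a quadratic in [k] with leading coefficient 1/4, which lies
       below [k^2] once [k >= 17]. *)
    apply Rle_trans with (INR k * INR k); auto.
    assert (INR k * ln (1 + INR m) <= INR k * (4 * ((INR k + 1) / 16 + 2)))
      by (apply Rmult_le_compat_l; lra).
    nra.
Qed.

(** With [n = 2^(T^2/2)] the claim is [4 n exp(-n e^(-2T)) <= 1]. For [T >= 16] the logarithm [y] of
    [n e^(-2T)] is at least [T^2/8 >= 2T], so [e^y >= (1 + y/2)^2 >= T^2], which exceeds
    [ln (4n)]. *)
Lemma many_vertices_negligible T : 16 <= T ->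
  4 * exp (ln 2 * (T * T) / 2)
    * exp (- (exp (ln 2 * (T * T) / 2) * exp (- (2 * T)))) <= 1.
Proof.
  intros HT. pose proof ln2_bounds as [Hl1 Hl2].
  set (y := ln 2 * (T * T) / 2 + - (2 * T)).
  assert (Hy : T * T / 8 <= y) by (unfold y; nra).
  rewrite <- exp_plus. fold y.
  assert (HE : T * T <= exp y).
  { replace y with (y / 2 + y / 2) by field. rewrite exp_plus.
    pose proof (exp_ineq1_le (y / 2)).
    assert (T <= y / 2) by nra.
    nra. }
  replace 4 with (exp (ln 2 + ln 2)) by (rewrite exp_plus, exp_ln; lra).
  rewrite <- !exp_plus, <- exp_0. apply exp_le_mono. nra.
Qed.

(** The product is [(p/m)^m 2^(m(m-1)/2)] times the rounding factor. Collecting exponents completes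
    a square: what remains is [ln 2 (m - T)^2 / 2 - m d], and [m] is within 1 of [T]. *)
Lemma light_path_estimate (T p d : R) (m : nat) :
  0 < p -> (1 <= m)%nat -> T <= INR m <= T + 1 -> 0 < T ->
  p <= INR m * exp (- d + ln 2 / 2 - ln 2 * T - 1) ->
  exp (ln 2 * (T * T) / 2) *
    (exp (INR m) * rprod (seq 0 m) (fun i => p * (1 + 2 ^ i / INR m)))
  <= exp (1 - INR m * d) * rounding_factor m.
Proof.
  intros Hp Hm HT HT0 Hp2.
  apply le_INR in Hm as HmR. simpl in HmR.
  assert (E : rprod (seq 0 m) (fun i => p * (1 + 2 ^ i / INR m)) =
    (p / INR m) ^ m * (exp (ln 2 * (INR m * (INR m - 1) / 2)) * rounding_factor m)).
  { assert (Etri : forall j, rprod (seq 0 j) (fun i => 2 ^ i)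
       = exp (ln 2 * (INR j * (INR j - 1) / 2))).
    { induction j as [|j IH].
      - unfold rprod; simpl. symmetry; rewrite <- exp_0; f_equal; field.
      - rewrite seq_S, rprod_app, IH. unfold rprod; cbn [map fold_right Nat.add].
        replace (2 ^ j) with (exp (INR j * ln 2))
          by (rewrite <- exp_pow_INR, exp_ln by lra; auto).
        rewrite Rmult_1_r, <- exp_plus, S_INR. f_equal; field. }
    rewrite <- Etri. unfold rounding_factor. rewrite <- rprod_mult.
    replace ((p / INR m) ^ m) with (rprod (seq 0 m) (fun _ => p / INR m))
      by (rewrite rprod_const, length_seq; auto).
    rewrite <- rprod_mult.
    apply rprod_ext; intros i _. assert (2 ^ i <> 0) by (apply pow_nonzero; lra).
    field; split; lra. }
  rewrite E.
  assert (Hpm : (p / INR m) ^ m <= exp (INR m * (- d + ln 2 / 2 - ln 2 * T - 1))).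
  { rewrite <- exp_pow_INR. apply pow_incr; split.
    - left; apply Rdiv_lt_0_compat; lra.
    - apply Rmult_le_reg_r with (INR m); [lra|].
      unfold Rdiv at 1; rewrite Rmult_assoc, Rinv_l by lra. lra. }
  assert (HQ : 0 <= rounding_factor m).
  { apply rprod_nonneg; intros i _.
    assert (0 <= INR m / 2 ^ i) by (apply Rle_mult_inv_pos; [lra|apply pow_lt; lra]). lra. }
  rewrite <- !Rmult_assoc. apply Rmult_le_compat_r; auto.
  eapply Rle_trans.
  - apply Rmult_le_compat_r; [left; apply exp_pos|].
    apply Rmult_le_compat_l; [|exact Hpm].
    apply Rmult_le_pos; left; apply exp_pos.
  - rewrite <- !exp_plus. apply exp_le_mono.
    pose proof ln2_bounds.
    assert (HD : (INR m - T) * (INR m - T) <= 1) by nra.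
    assert (ln 2 * ((INR m - T) * (INR m - T)) <= 1) by nra.
    lra.
Qed.

Lemma exp_neg_inv_le_div mu : 0 < mu -> exp (- / mu) <= 1 - / (1 + mu).
Proof.
  intros H. replace (1 - / (1 + mu)) with (/ (1 + / mu)) by (field; lra).
  rewrite exp_Ropp. assert (0 < / mu) by (apply Rinv_0_lt_compat; auto).
  apply Rinv_le_contravar; [lra|]. apply exp_ineq1_le.
Qed.

(** As [2^l <= 2^T] and [1/mu <= 2T 2^(-T)], a vertex has at least [2^l] pebbles with probability at
    least [exp(-2^l/mu) >= e^(-2T)]. Then [1 - z <= e^(-z)] is applied at each of the [N]
    vertices. *)
Lemma all_small_estimate (N : nat) (T mu : R) (l : nat) :
  0 < mu -> 0 < T -> INR l <= T -> INR N = exp (ln 2 * (T * T) / 2) ->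
  / mu <= 2 * T * exp (- (ln 2 * T)) ->
  (1 - (1 - / (1 + mu)) ^ (2 ^ l)) ^ N
    <= exp (- (exp (ln 2 * (T * T) / 2) * exp (- (2 * T)))).
Proof.
  intros Hmu HT Hl HN Hinv.
  set (q := 1 - / (1 + mu)).
  assert (Hq : exp (- / mu) <= q) by (apply exp_neg_inv_le_div; auto).
  assert (Hq1 : q < 1).
  { unfold q. assert (0 < / (1 + mu)) by (apply Rinv_0_lt_compat; lra). lra. }
  assert (Hq2 : exp (- (2 * T)) <= q ^ (2 ^ l)).
  { apply Rle_trans with (exp (- / mu) ^ (2 ^ l)).
    - rewrite exp_pow_INR. apply exp_le_mono.
      rewrite pow_INR. replace (INR 2) with (exp (ln 2)) by (rewrite exp_ln; simpl; lra).
      rewrite exp_pow_INR.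
      assert (exp (INR l * ln 2) <= exp (ln 2 * T)).
      { apply exp_le_mono. pose proof ln2_bounds. nra. }
      assert (exp (INR l * ln 2) * / mu <= exp (ln 2 * T) * (2 * T * exp (- (ln 2 * T)))).
      { apply Rmult_le_compat; auto; left; [apply exp_pos|apply Rinv_0_lt_compat; auto]. }
      assert (exp (ln 2 * T) * exp (- (ln 2 * T)) = 1)
        by (rewrite <- exp_plus, Rplus_opp_r; apply exp_0).
      nra.
    - apply pow_incr; split; auto; left; apply exp_pos. }
  assert (Hq3 : q ^ (2 ^ l) <= 1).
  { apply Rle_trans with (1 ^ (2 ^ l)); [apply pow_incr|rewrite pow1; lra].
    pose proof (exp_pos (- / mu)); lra. }
  apply Rle_trans with (exp (- exp (- (2 * T))) ^ N).
  - apply pow_incr; split; [lra|].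
    pose proof (exp_ineq1_le (- exp (- (2 * T)))). lra.
  - rewrite exp_pow_INR, HN. right; f_equal; ring.
Qed.

(** The right side is the inverse of [threshold_bound n / n], rewritten by [2 sqrt L = sqrt 2 T]
    into the exponential form that [light_path_estimate] expects. *)
Lemma inv_mean_le (n : nat) (x : R) :
  let L := log2 (INR n) in let T := sqrt (2 * L) in
  (1 < n)%nat -> 1 < L -> threshold_bound n < x ->
  0 < x /\
  / (x / INR n) <= (1 - Rpower L (- (1 / 4))) * (T * exp (ln 2 / 2 - ln 2 * T - 1)).
Proof.
  intros L T Hn HL Hx. unfold threshold_bound in Hx. fold L in Hx. fold T in Hx.
  pose proof ln2_bounds as [Hl1 Hl2].
  assert (Hn0 : 0 < INR n) by (apply lt_0_INR; lia).
  assert (Hd : 0 < 1 - Rpower L (- (1 / 4))).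
  { assert (Rpower L (- (1 / 4)) < Rpower L 0) by (apply Rpower_lt; lra).
    rewrite Rpower_O in *; lra. }
  set (d := Rpower L (- (1 / 4))) in *.
  assert (HT : 0 < T) by (apply sqrt_lt_R0; lra).
  assert (Hsq : 2 * sqrt L = exp (ln 2 / 2) * T).
  { unfold T. rewrite sqrt_mult by lra.
    replace (exp (ln 2 / 2)) with (sqrt 2).
    - rewrite <- Rmult_assoc, sqrt_sqrt; lra.
    - rewrite <- Rpower_sqrt by lra. unfold Rpower. f_equal; field. }
  rewrite Hsq in Hx. unfold Rpower at 1 in Hx.
  set (B := exp (T * ln 2) * exp 1 / (exp (ln 2 / 2) * T) * / (1 - d)) in *.
  pose proof (exp_pos (T * ln 2)); pose proof (exp_pos 1); pose proof (exp_pos (ln 2 / 2)).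
  assert (HB : 0 < B).
  { unfold B. apply Rmult_lt_0_compat; [|apply Rinv_0_lt_compat; auto].
    apply Rdiv_lt_0_compat; apply Rmult_lt_0_compat; auto. }
  assert (Hx0 : 0 < x) by nra.
  split; auto.
  apply Rle_trans with (/ B).
  - apply Rinv_le_contravar; auto.
    apply Rmult_le_reg_r with (INR n); auto.
    unfold Rdiv; rewrite Rmult_assoc, Rinv_l by lra. lra.
  - right. unfold B, Rminus. rewrite !exp_plus, !exp_Ropp, (Rmult_comm (ln 2) T).
    field. repeat split; lra.
Qed.

(** Here [T^2/2] is [L], and [L <= m^2] gives [L^(-1/4) >= m^(-1/2)]. *)
Lemma decay_exponent_ge (T : R) (m : nat) : 1 < T -> T <= INR m ->
  sqrt (INR m) <= INR m * Rpower (T * T / 2) (- (1 / 4)).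
Proof.
  intros HT Hm.
  assert (Hle : Rpower (INR m) (- (1 / 2)) <= Rpower (T * T / 2) (- (1 / 4))).
  { replace (- (1 / 2)) with ((1 + 1) * - (1 / 4)) by field.
    unfold Rpower. apply exp_le_mono.
    assert (ln (T * T / 2) <= (1 + 1) * ln (INR m)); [|lra].
    replace ((1 + 1) * ln (INR m)) with (ln (INR m * INR m)) by (rewrite ln_mult by lra; ring).
    left; apply ln_increasing; nra. }
  apply Rle_trans with (INR m * Rpower (INR m) (- (1 / 2))).
  - right. rewrite <- (Rpower_1 (INR m)) at 2 by lra.
    rewrite <- Rpower_plus, <- Rpower_sqrt by lra. f_equal; field.
  - apply Rmult_le_compat_l; lra.
Qed.

(** * Passage to the limit and conclusion *)

Lemma solvable_prob_limit_ge n adj p b c :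
  0 < p <= 1 ->
  (forall M r, (r < n)%nat -> partial_prob n p M (fun D => ~ pebblable n adj D r) <= b) ->
  Un_cv (solvable_prob_partial n adj p) c -> 1 - INR n * b <= c.
Proof.
  intros Hp Hb Hc.
  apply Rnot_lt_le; intros Hlt.
  (* Half of the supposed gap pays for the distance to the limit [c], the other half for the mass
     lost by truncation. *)
  set (e := (1 - INR n * b - c) / 2).
  assert (He : 0 < e) by (unfold e; lra).
  assert (Hn : 0 < INR n + 1) by (pose proof (pos_INR n); lra).
  destruct (Hc e He) as [N1 H1].
  assert (Habs : Rabs (1 - p) < 1) by (rewrite Rabs_right; lra).
  destruct (pow_lt_1_zero (1 - p) Habs (e / (INR n + 1))) as [N2 H2].
  { apply Rdiv_lt_0_compat; auto. }
  set (M := Nat.max N1 N2).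
  specialize (H1 M ltac:(lia)). unfold Rdist in H1. apply Rabs_def2 in H1.
  specialize (H2 (S M) ltac:(lia)).
  assert (Hq0 : 0 <= (1 - p) ^ S M) by (apply pow_le; lra).
  rewrite Rabs_right in H2 by lra.
  pose proof (union_bound n adj p M b Hp (Hb M)) as HU.
  set (y := (1 - p) ^ S M) in *.
  assert (Hy1 : y <= 1).
  { unfold y. apply Rle_trans with (1 ^ S M); [apply pow_incr; split; lra|rewrite pow1; lra]. }
  (* Bernoulli's inequality bounds the truncated mass from below. *)
  assert (HBern : 1 - INR n * y <= (1 - y) ^ n).
  { generalize n; intros k; induction k as [|k IH]; [simpl; lra|].
    rewrite S_INR; cbn [pow]. pose proof (pos_INR k). nra. }
  assert (INR n * y <= e).
  { apply Rmult_lt_compat_r with (r := INR n + 1) in H2; auto.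
    unfold Rdiv in H2; rewrite Rmult_assoc, Rinv_l in H2 by lra. nra. }
  unfold e in *; lra.
Qed.

Theorem theorem25 :
  exists n0 : nat, (3 <= n0)%nat /\
    forall (n : nat) (adj : nat -> nat -> Prop),
      (n0 <= n)%nat -> simple_graph n adj -> connected n adj ->
      forall x : R, is_geom_threshold n adj x -> x <= threshold_bound n.
Proof.
  (* [rounding_factor_subexp] asks for [m >= 17^4], and [many_vertices_negligible] for [T >= 16].
     Taking [n > 2^(T0^2/2)] ensures [T > T0]. *)
  set (T0 := INR (17 ^ 4)).
  assert (HT0 : 16 <= T0).
  { replace 16 with (INR 16) by (simpl; lra). apply le_INR.
    apply Nat.leb_le; vm_compute; reflexivity. }
  destruct (INR_unbounded (exp (ln 2 * (T0 * T0) / 2))) as [n1 Hn1].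
  exists (Nat.max 3 n1); split; [lia|].
  intros n adj Hn _ HC x [_ Hcv].
  apply Rnot_lt_le; intros Hx.
  pose proof ln2_bounds as [Hl1 Hl2].
  set (L := log2 (INR n)). set (T := sqrt (2 * L)).
  assert (HnR : exp (ln 2 * (T0 * T0) / 2) < INR n).
  { eapply Rlt_le_trans; [exact Hn1|apply le_INR; lia]. }
  assert (Hn0 : 0 < INR n) by (pose proof (exp_pos (ln 2 * (T0 * T0) / 2)); lra).
  assert (HL : T0 * T0 < 2 * L).
  { apply ln_increasing in HnR; [|apply exp_pos]. rewrite ln_exp in HnR.
    unfold L, log2. apply Rmult_lt_reg_l with (ln 2 / 2); [lra|].
    replace (ln 2 / 2 * (2 * (ln (INR n) / ln 2))) with (ln (INR n)) by (field; lra). lra. }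
  assert (HTT : T * T = 2 * L) by (apply sqrt_sqrt; nra).
  assert (HT : T0 < T).
  { unfold T. rewrite <- (sqrt_square T0) by lra. apply sqrt_lt_1; nra. }
  assert (HnT : INR n = exp (ln 2 * (T * T) / 2)).
  { rewrite HTT. unfold L, log2.
    replace (ln 2 * (2 * (ln (INR n) / ln 2)) / 2) with (ln (INR n)) by (field; lra).
    rewrite exp_ln; auto. }
  destruct (inv_mean_le n x) as [Hx0 Hmean]; [lia|fold L; nra|exact Hx|].
  fold L in Hmean; fold T in Hmean.
  set (d := Rpower L (- (1 / 4))) in *. set (mu := x / INR n) in *.
  assert (Hmu : 0 < mu) by (apply Rdiv_lt_0_compat; auto).
  (* [l] is the floor of [T]; a path with [l] edges has [m = l + 1] vertices, and [m] is the least
     integer above [T]. *)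
  assert (Hl : exists l : nat, INR l <= T < INR l + 1).
  { destruct (archimed T) as [A1 A2].
    exists (Z.to_nat (up T - 1)).
    assert (0 < up T)%Z by (apply lt_IZR; lra).
    rewrite INR_IZR_INZ, Z2Nat.id, minus_IZR by lia. lra. }
  destruct Hl as [l [HlT HTl]]. set (m := S l).
  assert (Hm : INR m = INR l + 1) by apply S_INR.
  assert (Hp : 0 < geom_param n x <= 1).
  { unfold geom_param. fold mu. split; [apply Rinv_0_lt_compat; lra|].
    rewrite <- Rinv_1 at 2. apply Rinv_le_contravar; lra. }
  assert (Hd0 : 0 < d) by apply exp_pos.
  assert (HF : 0 < T * exp (ln 2 / 2 - ln 2 * T - 1))
    by (apply Rmult_lt_0_compat; [lra|apply exp_pos]).
  (* Failure probability [1/(4n)] per root forces the limit to be at least 3/4, against the value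
     1/2 at the threshold. *)
  enough (Hb : forall M r, (r < n)%nat ->
    partial_prob n (geom_param n x) M (fun D => ~ pebblable n adj D r) <= / (4 * INR n)).
  { pose proof (solvable_prob_limit_ge _ _ _ _ _ Hp Hb Hcv) as H.
    replace (INR n * / (4 * INR n)) with (1 / 4) in H by (field; lra). lra. }
  intros M r Hr.
  apply Rmult_le_reg_l with (4 * INR n); [lra|]. rewrite Rinv_r by lra.
  destruct (unpebblable_dichotomy n adj r l HC Hr) as [Hsmall|(w & Hw & Hi & Hlight)].
  - apply Rle_trans with (4 * INR n *
      exp (- (exp (ln 2 * (T * T) / 2) * exp (- (2 * T))))).
    + apply Rmult_le_compat_l; [lra|].
      eapply Rle_trans; [apply partial_prob_all_small; eauto|].
      apply all_small_estimate; auto; [lra|].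
      eapply Rle_trans; [exact Hmean|].
      (* A crude bound on [1/mu] suffices here: [1 - d <= 1] and [exp (ln 2 / 2 - 1) <= 2]. *)
      apply Rle_trans with (1 * (T * exp (ln 2 / 2 - ln 2 * T - 1))).
      * apply Rmult_le_compat_r; lra.
      * rewrite Rmult_1_l, (Rmult_comm 2), Rmult_assoc.
        apply Rmult_le_compat_l; [lra|].
        replace 2 with (exp (ln 2)) at 4 by (apply exp_ln; lra).
        rewrite <- exp_plus. apply exp_le_mono. lra.
    + rewrite HnT. apply many_vertices_negligible; lra.
  - apply Rle_trans with (4 * (exp 1 * rounding_factor m / exp (sqrt (INR m)))).
    + rewrite Rmult_assoc. apply Rmult_le_compat_l; [lra|].
      apply Rle_trans with (exp (1 - INR m * d) * rounding_factor m).
      * eapply Rle_trans.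
        { apply Rmult_le_compat_l; [lra|].
          apply (partial_prob_light_path n _ M w l (INR m)); auto; lra. }
        rewrite HnT. apply light_path_estimate; try lra; [lia|].
        apply Rle_trans with (/ mu).
        { unfold geom_param; fold mu. apply Rinv_le_contravar; lra. }
        eapply Rle_trans; [exact Hmean|].
        (* The gain [1 - d <= e^(-d)] enters each of the [m] factors and accumulates to
           [e^(-m d)]. *)
        pose proof (exp_ineq1_le (- d)).
        replace (- d + ln 2 / 2 - ln 2 * T - 1) with
          (- d + (ln 2 / 2 - ln 2 * T - 1)) by ring.
        rewrite exp_plus.
        pose proof (exp_pos (ln 2 / 2 - ln 2 * T - 1)). pose proof (exp_pos (- d)).
        set (F := exp (ln 2 / 2 - ln 2 * T - 1)) in *.
        apply Rle_trans with (exp (- d) * (T * F)).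
        { apply Rmult_le_compat_r; lra. }
        assert (0 < exp (- d) * F) by (apply Rmult_lt_0_compat; auto).
        nra.
      * unfold Rdiv. rewrite <- exp_Ropp.
        replace (exp 1 * rounding_factor m * exp (- sqrt (INR m))) with
          (exp (1 - sqrt (INR m)) * rounding_factor m)
          by (unfold Rminus; rewrite exp_plus; ring).
        apply Rmult_le_compat_r.
        { apply rprod_nonneg; intros i _.
          assert (0 <= INR m / 2 ^ i)
            by (apply Rle_mult_inv_pos; [apply pos_INR|apply pow_lt; lra]). lra. }
        apply exp_le_mono.
        pose proof (decay_exponent_ge T m ltac:(lra) ltac:(lra)) as HD.
        replace (T * T / 2) with L in HD by lra. fold d in HD. lra.
    + pose proof (exp_pos (sqrt (INR m))).
      apply Rmult_le_reg_r with (exp (sqrt (INR m))); auto.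
      replace (4 * (exp 1 * rounding_factor m / exp (sqrt (INR m))) * exp (sqrt (INR m)))
        with (4 * exp 1 * rounding_factor m) by (field; lra).
      rewrite Rmult_1_l. apply rounding_factor_subexp.
      apply INR_le. fold T0. lra.
Qed.
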